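(* Let $q\in(0,1)$ and let $\gamma>0$ be real. Put $b_n=\frac{1}{[n]_q!}\prod_{i=0}^{n-1}[\gamma+i]_q$ for integers $n\ge0$ and $b_n=0$ for $n<0$. For $0<p\le1$ define $$\mathfrak S(q)=\Big\{a=(a_j)\in\omega:\ \sup_{J\in\mathcal Z}\ \sup_{k\in\mathbb{Z}^+_0}\Big|\sum_{j\in J}b_{j-k}\,a_j\Big|^{p}<\infty\Big\},$$ and for $1\le s<\infty$ define $$\mathfrak S^{(s)}(q)=\Big\{a=(a_j)\in\omega:\ \sup_{J\in\mathcal Z}\ \sum_{k=0}^\infty\Big|\sum_{j\in J}b_{j-k}\,a_j\Big|^{s}<\infty\Big\}.$$ Then: (1) $\{\ell_p(\nabla^{(\gamma)}_q)\}^\alpha=\mathfrak S(q)$ if $0<p\le1$, and $\{\ell_p(\nabla^{(\gamma)}_q)\}^\alpha=\mathfrak S^{(p')}(q)$ if $1<p<\infty$, where $\frac1p+\frac1{p'}=1$. (2) $\{\ell_\infty(\nabla^{(\gamma)}_q)\}^\alpha=\mathfrak S^{(1)}(q)$.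
   Context: $\mathbb{Z}^+_0=\{0,1,2,\dots\}$; $\mathcal Z$ is the collection of all finite subsets of $\mathbb{Z}^+_0$; $\omega$ is the space of all complex sequences $(g_j)_{j\in\mathbb{Z}^+_0}$. For real $x$, $[x]_q=\frac{1-q^x}{1-q}$; $[0]_q!=1$ and $[k]_q!=\prod_{i=1}^k[i]_q$. Empty products equal $1$. The $q$-difference operator $\nabla^{(\gamma)}_q:\omega\to\omega$ is $$(\nabla^{(\gamma)}_q g)_j=\sum_{k=0}^{j}(-1)^{j-k}q^{\binom{j-k}{2}}\frac{\prod_{i=0}^{j-k-1}[\gamma-i]_q}{[j-k]_q!}\,g_k,$$ and $\mathfrak X(\nabla^{(\gamma)}_q)=\{g\in\omega:\nabla^{(\gamma)}_q g\in\mathfrak X\}$ for $\mathfrak X\in\{\ell_p,\ell_\infty\}$. The $\alpha$-dual of a sequence space $\mathfrak X$ is $\mathfrak X^\alpha=\{a\in\omega:(a_jg_j)_j\in\ell_1\text{ for every }g\in\mathfrak X\}$. *)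

(* Defs.v *)
From HB Require Import structures.
From mathcomp Require Import all_boot all_order all_algebra finmap.
From mathcomp Require Import all_classical all_reals all_analysis.
From mathcomp Require Import complex.

Set Implicit Arguments.
Unset Strict Implicit.
Unset Printing Implicit Defensive.

Import Order.TTheory GRing.Theory Num.Theory.

Local Open Scope classical_set_scope.
Local Open Scope ring_scope.
Local Open Scope complex_scope.

(* Moduli are taken with [Normc.normc], which is real-valued, because the norm
   [`|z|] of [z : R[i]] lives in [R[i]] and [powR] needs a real base. *)

Definition qnum (R : realType) (q x : R) : R := (1 - q `^ x) / (1 - q).

Definition qfact (R : realType) (q : R) (k : nat) : R :=
  \prod_(1 <= i < k.+1) qnum q i%:R.

Definition nabla (R : realType) (q gamma : R) (g : nat -> R[i]) : nat -> R[i] :=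
  fun j => \sum_(0 <= k < j.+1)
    ((-1) ^+ (j - k) * q ^+ 'C(j - k, 2)
      * (\prod_(0 <= i < j - k) qnum q (gamma - i%:R)) / qfact q (j - k))%:C
    * g k.

Definition ell (R : realType) (p : R) : set (nat -> R[i]) :=
  [set g | (\sum_(0 <= k <oo) (Normc.normc (g k) `^ p)%:E < +oo)%E].

Definition ell_infty (R : realType) : set (nat -> R[i]) :=
  [set g | (ereal_sup [set (Normc.normc (g k))%:E | k in [set: nat]] < +oo)%E].

Definition nabla_domain (R : realType) (q gamma : R)
    (X : set (nat -> R[i])) : set (nat -> R[i]) :=
  [set g | X (nabla q gamma g)].

Definition alpha_dual (R : realType) (X : set (nat -> R[i])) :
    set (nat -> R[i]) :=
  [set a | forall g, X g -> ell 1 (fun j => a j * g j)].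

Definition bcoef (R : realType) (q gamma : R) (n : int) : R :=
  match n with
  | Posz m => (qfact q m)^-1 * \prod_(0 <= i < m) qnum q (gamma + i%:R)
  | Negz _ => 0
  end.

Definition bsum (R : realType) (q gamma : R) (a : nat -> R[i])
    (J : {fset nat}) (k : nat) : R[i] :=
  \sum_(j <- J) (bcoef q gamma (j%:Z - k%:Z))%:C * a j.

Definition S_sup (R : realType) (q gamma p : R) : set (nat -> R[i]) :=
  [set a | (ereal_sup
    [set ereal_sup
       [set (Normc.normc (bsum q gamma a J k) `^ p)%:E | k in [set: nat]]
    | J in [set: {fset nat}]] < +oo)%E].

Definition S_sum (R : realType) (q gamma s : R) : set (nat -> R[i]) :=
  [set a | (ereal_sup
    [set (\sum_(0 <= k <oo) (Normc.normc (bsum q gamma a J k) `^ s)%:E)%E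
    | J in [set: {fset nat}]] < +oo)%E].

(* Main.v *)
Require Import Defs.
From mathcomp Require Import all_boot all_order all_algebra finmap.
From mathcomp Require Import all_classical all_reals all_analysis.
From mathcomp Require Import complex.
From mathcomp Require Import ring lra.

(** Up to a change of variable, the difference operator is invertible.  It is
convolution by the sequence [ncoef], whose generating function is
(z; q)_oo / (q^gamma z; q)_oo, while the b_n are the coefficients of the
inverse of that function.  Hence g lies in X(nabla) exactly when g = b * f
with f = nabla g in X, and the alpha-dual consists of the a for which the
matrix (a_j b_(j-k)) maps X into l_1 ([bconv_nabla], [nabla_bconv]).

Since gamma > 0 makes every b_n nonnegative, no cancellation has to be tracked.
Put B_N(k) = sum_(j < N) b_(j-k) |a_j| ([colsum]).
- The sequence spaces depend on moduli only, so f may be taken nonnegative; an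
  exchange of two finite sums then turns absolute convergence into boundedness
  in N of sum_k f_k B_N(k), for every nonnegative f in X ([alpha_dual_nablaP]).
- For a finite set J, the modulus of sum_(j in J) b_(j-k) a_j is at most
  B_N(k) for N large.  Conversely B_N(k) is at most the sum of four such
  moduli, for the sets of indices below N at which Re a_j, or Im a_j, is
  nonnegative, or negative.  So the suprema over J of the statement are finite
  exactly when the corresponding quantities built on B_N are bounded in N
  ([S_supP], [S_sumP]).

What remains is the Koethe duality of l_p for the nonnegative array B_N(k).
For l_oo, test with f = 1.  For l_p, Young's inequality (p > 1) or the
inclusion of l_p in l_1 (p <= 1) gives one direction.  For the other, a gliding
hump argument, valid for all p > 0, makes the bound on sum_k f_k B_N(k) uniform
over the unit ball of l_p ([uniform_bound]); the uniform bound is then tested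
on unit vectors when p <= 1 and on the normalized powers B_N(k)^(p'-1) when
p > 1. *)

Set Implicit Arguments.
Unset Strict Implicit.
Unset Printing Implicit Defensive.

Import Order.TTheory GRing.Theory Num.Theory Normc.

Local Open Scope ring_scope.
Local Open Scope complex_scope.

(** * Convolution of sequences *)

Definition conv (A : pzRingType) (f g : nat -> A) (n : nat) : A :=
  \sum_(0 <= k < n.+1) f (n - k)%N * g k.

(** Truncating to degree below N does not change the coefficients of index
below N of a product; this transfers the ring laws of polynomials to [conv]. *)
Lemma coef_conv (A : nzRingType) (f g : nat -> A) N n : (n < N)%N ->
  conv f g n = (\poly_(i < N) f i * \poly_(i < N) g i)`_n.
Proof.
move=> nN; rewrite coefMr /conv big_mkord; apply: eq_bigr => k _.
rewrite !coef_poly (leq_ltn_trans (leq_subr _ _) nN).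
by rewrite (leq_ltn_trans _ nN) // -ltnS.
Qed.

Lemma convA (A : nzRingType) (f g h : nat -> A) n :
  conv f (conv g h) n = conv (conv f g) h n.
Proof.
have poly_conv u v i : (i < n.+1)%N -> (\poly_(j < n.+1) conv u v j)`_i =
    (\poly_(j < n.+1) u j * \poly_(j < n.+1) v j : {poly A})`_i.
  by move=> ilt; rewrite coef_poly ilt (coef_conv _ _ ilt).
rewrite !(coef_conv _ _ (ltnSn n)).
transitivity ((\poly_(i < n.+1) f i *
   (\poly_(i < n.+1) g i * \poly_(i < n.+1) h i))`_n).
  rewrite !coefMr; apply: eq_bigr => k _; congr (_ * _).
  exact: poly_conv.
rewrite mulrA [LHS]coefMr [RHS]coefMr; apply: eq_bigr => k _; congr (_ * _).
by rewrite poly_conv // ltnS leq_subr.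
Qed.

Lemma convC (A : comNzRingType) (f g : nat -> A) n : conv f g n = conv g f n.
Proof. by rewrite !(coef_conv _ _ (ltnSn n)) mulrC. Qed.

Lemma conv_morph (A B : pzRingType) (h : {rmorphism A -> B}) (f g : nat -> A) n :
  conv (h \o f) (h \o g) n = h (conv f g n).
Proof.
by rewrite /conv rmorph_sum; apply: eq_bigr => k _; rewrite rmorphM.
Qed.

Lemma conv_unitl (A : pzRingType) (e f : nat -> A) n :
  (forall i, e i = (i == 0%N)%:R) -> conv e f n = f n.
Proof.
move=> eE; rewrite /conv big_nat_recr //= big1_seq ?add0r.
  by rewrite subnn eE eqxx mul1r.
move=> k /andP[_]; rewrite mem_index_iota => /andP[_ kn].
by rewrite eE subn_eq0 leqNgt kn mul0r.
Qed.

(** * The coefficients of the difference operator and of its inverse *)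

Lemma qnum_gt0 (R : realType) (q x : R) :
  0 < q -> q < 1 -> 0 < x -> 0 < qnum q x.
Proof.
move=> q0 q1 x0; rewrite /qnum divr_gt0 ?subr_gt0 //.
by rewrite /powR gt_eqF // expR_lt1 pmulr_rlt0 // ln_lt0 // q0 q1.
Qed.

Lemma qfact_gt0 (R : realType) (q : R) n : 0 < q -> q < 1 -> 0 < qfact q n.
Proof.
move=> q0 q1; rewrite /qfact big_nat_cond prodr_gt0 // => i.
by rewrite andbT => /andP[i0 _]; rewrite qnum_gt0 // ltr0n.
Qed.

Lemma qfactS (R : realType) (q : R) n :
  qfact q n.+1 = qfact q n * qnum q n.+1%:R.
Proof. by rewrite /qfact big_nat_recr. Qed.

(** The coefficients of [nabla], which is convolution by this sequence. *)
Definition ncoef (R : realType) (q gamma : R) (n : nat) : R :=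
  (-1) ^+ n * q ^+ 'C(n, 2) * (\prod_(0 <= i < n) qnum q (gamma - i%:R))
    / qfact q n.

(** Coefficient form of W(z) (1 - q^gamma z) = (1 - z) W(q z), the functional
equation of the generating function W of [ncoef]. *)
Lemma ncoefS (R : realType) (q gamma : R) n : 0 < q -> q < 1 ->
  (1 - q ^+ n.+1) * ncoef q gamma n.+1 = (q `^ gamma - q ^+ n) * ncoef q gamma n.
Proof.
move=> q0 q1; have f0 := lt0r_neq0 (qfact_gt0 n q0 q1).
have e0 : 1 - q ^+ n.+1 != 0.
  by rewrite subr_eq0 eq_sym lt_eqF // exprn_ilt1 ?ltW.
have e1 : 1 - q != 0 by rewrite subr_eq0 eq_sym lt_eqF.
have qn0 : q ^+ n != 0 by rewrite expf_neq0 ?gt_eqF.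
rewrite /ncoef big_nat_recr //= qfactS binS bin1 exprD.
rewrite /qnum powRB ?(lt0r_neq0 q0) ?implybT // !powR_mulrn ?(ltW q0) //.
rewrite !exprS in e0 *; field.
by rewrite e0 e1 f0 qn0.
Qed.

(** Coefficient form of the functional equation of the generating function of
the b_n, in which the factors 1 - z and 1 - q^gamma z of [ncoefS] are
exchanged. *)
Lemma bcoefS (R : realType) (q gamma : R) (n : nat) : 0 < q -> q < 1 ->
  (1 - q ^+ n.+1) * bcoef q gamma n.+1 =
  (1 - q `^ gamma * q ^+ n) * bcoef q gamma n.
Proof.
move=> q0 q1; have f0 := lt0r_neq0 (qfact_gt0 n q0 q1).
have e0 : 1 - q ^+ n.+1 != 0.
  by rewrite subr_eq0 eq_sym lt_eqF // exprn_ilt1 ?ltW.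
have e1 : 1 - q != 0 by rewrite subr_eq0 eq_sym lt_eqF.
rewrite /bcoef big_nat_recr //= qfactS /qnum powRD ?(lt0r_neq0 q0) ?implybT //.
rewrite !powR_mulrn ?(ltW q0) //; field.
by rewrite e0 e1 f0.
Qed.

Lemma bcoef_ge0 (R : realType) (q gamma : R) (n : int) :
  0 < q -> q < 1 -> 0 < gamma -> 0 <= bcoef q gamma n.
Proof.
case: n => // n q0 q1 g0; rewrite /bcoef mulr_ge0 ?invr_ge0 ?ltW ?qfact_gt0 //.
by rewrite prodr_gt0 // => i _; rewrite qnum_gt0 // ltr_wpDr.
Qed.

(** By [ncoefS] and [bcoefS] the product P of the two generating functions
satisfies P(q z) = P(z), hence is constant.  On coefficients this is done
without cancelling the factors 1 - z and 1 - q^gamma z: splitting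
1 - q^m = (1 - q^k) + q^k (1 - q^(m-k)) yields the first order recurrence
(1 - q^(m+1)) p_(m+1) = q^gamma (1 - q^m) p_m, which vanishes at m = 0. *)
Lemma conv_bcoef_ncoef (R : realType) (q gamma : R) n : 0 < q -> q < 1 ->
  conv (fun m : nat => bcoef q gamma m) (ncoef q gamma) n = (n == 0%N)%:R.
Proof.
move=> q0 q1; set b := fun m : nat => bcoef q gamma m; set w := ncoef q gamma.
set u := q `^ gamma.
have rec m : (1 - q ^+ m.+1) * conv b w m.+1 = u * (1 - q ^+ m) * conv b w m.
  transitivity
    (\sum_(0 <= k < m.+2) b (m.+1 - k)%N * ((1 - q ^+ k) * w k) +
     \sum_(0 <= k < m.+2) q ^+ k * ((1 - q ^+ (m.+1 - k)) * b (m.+1 - k)%N) * w k).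
    rewrite /conv mulr_sumr -big_split /= !big_nat; apply: eq_bigr => k /andP[_ km].
    by rewrite -{1}(subnK (_ : (k <= m.+1)%N)) // exprD; ring.
  (* The first sum starts at k = 1 and the second one stops at k = m: shift the
     former so that the two recurrences produce the same products. *)
  rewrite big_nat_recl //= expr0 subrr mul0r mulr0 add0r.
  rewrite [X in _ + X]big_nat_recr //= subnn expr0 subrr mul0r mulr0 mul0r addr0.
  rewrite /conv mulr_sumr -big_split /= !big_nat; apply: eq_bigr => k /andP[_ km].
  rewrite subSS (ncoefS _ _ q0 q1) subSn -1?ltnS // (bcoefS _ _ q0 q1).
  rewrite -/u -/w -/(b _) -{4}(subnK (_ : (k <= m)%N)) -1?ltnS // exprD; ring.
have nz m : 1 - q ^+ m.+1 != 0.
  by rewrite subr_eq0 eq_sym lt_eqF // exprn_ilt1 ?ltW.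
case: n => [|n].
  rewrite /conv big_nat1 subnn /b /w /bcoef /ncoef !big_geq // /qfact big_geq //.
  by rewrite bin0n expr0 invr1 !mulr1.
elim: n => [|n IH].
  by apply: (mulfI (nz 0%N)); rewrite rec expr0 subrr !(mulr0, mul0r).
by apply: (mulfI (nz n.+1)); rewrite rec IH !mulr0.
Qed.

Definition bconv (R : realType) (q gamma : R) : (nat -> R[i]) -> nat -> R[i] :=
  conv (fun n : nat => (bcoef q gamma n)%:C).

Lemma bconv_nabla (R : realType) (q gamma : R) (g : nat -> R[i]) :
  0 < q -> q < 1 -> bconv q gamma (nabla q gamma g) = g.
Proof.
move=> q0 q1; apply/funext => n.
rewrite /bconv -[nabla q gamma g]/(conv (fun n => (ncoef q gamma n)%:C) g).
rewrite convA conv_unitl // => i.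
rewrite (conv_morph (real_complex R)) conv_bcoef_ncoef //.
by rewrite -[LHS]/(real_complex R _) rmorph_nat.
Qed.

Lemma nabla_bconv (R : realType) (q gamma : R) (f : nat -> R[i]) :
  0 < q -> q < 1 -> nabla q gamma (bconv q gamma f) = f.
Proof.
move=> q0 q1; apply/funext => n.
rewrite -[nabla _ _ _]/(conv (fun n => (ncoef q gamma n)%:C) _).
rewrite convA conv_unitl // => i; rewrite convC.
rewrite (conv_morph (real_complex R)) conv_bcoef_ncoef //.
by rewrite -[LHS]/(real_complex R _) rmorph_nat.
Qed.

(** * Moduli of complex numbers *)

Lemma normc_ge0 (R : realType) (z : R[i]) : 0 <= normc z.
Proof. by case: z => x y; rewrite sqrtr_ge0. Qed.

Lemma normc_real (R : realType) (x : R) : normc x%:C = `|x|.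
Proof. by rewrite /= expr0n addr0 sqrtr_sqr. Qed.

Lemma normc_realM (R : realType) (x : R) (z : R[i]) :
  0 <= x -> normc (x%:C * z) = x * normc z.
Proof. by move=> x0; rewrite normcM normc_real ger0_norm. Qed.

Lemma normc_sum (R : realType) (I : Type) (r : seq I) (P : pred I)
    (z : I -> R[i]) :
  normc (\sum_(i <- r | P i) z i) <= \sum_(i <- r | P i) normc (z i).
Proof.
elim/big_rec2: _ => [|i x y _ le_yx]; first by rewrite normc0.
exact: le_trans (le_normcD _ _) (lerD _ _).
Qed.

Lemma Re_le_normc (R : realType) (z : R[i]) : `|complex.Re z| <= normc z.
Proof.
by case: z => x y /=; rewrite -sqrtr_sqr ler_wsqrtr // lerDl sqr_ge0.
Qed.

Lemma Im_le_normc (R : realType) (z : R[i]) : `|complex.Im z| <= normc z.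
Proof.
by case: z => x y /=; rewrite -sqrtr_sqr ler_wsqrtr // lerDr sqr_ge0.
Qed.

Lemma normc_le_ReIm (R : realType) (z : R[i]) :
  normc z <= `|complex.Re z| + `|complex.Im z|.
Proof.
case: z => x y /=; rewrite -[leRHS]ger0_norm ?addr_ge0 // -sqrtr_sqr.
rewrite ler_wsqrtr // sqrrD !real_normK ?num_real // lerD2r lerDl.
by rewrite mulrn_wge0 ?mulr_ge0.
Qed.

(** * Extended real bounds as bounds on finite sums *)

Definition bounded_series (R : realType) (u : nat -> R) : Prop :=
  exists M, forall N, \sum_(0 <= k < N) u k <= M.

Lemma nneseries_leP (R : realType) (u : nat -> R) (M : R) :
  (forall k, 0 <= u k) ->
  (\sum_(0 <= k <oo) (u k)%:E <= M%:E)%E <->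
  (forall N, \sum_(0 <= k < N) u k <= M).
Proof.
move=> u0; have u0E k : (0 <= (u k)%:E)%E by rewrite lee_fin.
split=> [le_uM N|le_uM].
  by rewrite -lee_fin -sumEFin (le_trans _ le_uM) // nneseries_lim_ge.
apply: lime_le; first exact: is_cvg_nneseries.
by apply: nearW => N; rewrite sumEFin lee_fin.
Qed.

Lemma nneseries_ltyP (R : realType) (u : nat -> R) : (forall k, 0 <= u k) ->
  (\sum_(0 <= k <oo) (u k)%:E < +oo)%E <-> bounded_series u.
Proof.
move=> u0; split=> [u_fin|[M /nneseries_leP le_uM]]; last first.
  exact: le_lt_trans (le_uM u0) (ltry _).
have s0 : (0 <= \sum_(0 <= k <oo) (u k)%:E)%E.
  by apply: nneseries_ge0 => k _ _; rewrite lee_fin.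
exists (fine (\sum_(0 <= k <oo) (u k)%:E)%E); apply/nneseries_leP => //.
by rewrite fineK // ge0_fin_numE.
Qed.

Lemma ereal_sup_ltyP (R : realType) (I : Type) (f : I -> \bar R) :
  (ereal_sup [set f i | i in [set: I]]%classic < +oo)%E <->
  exists M : R, forall i, (f i <= M%:E)%E.
Proof.
split=> [sup_fin|[M le_fM]]; last first.
  apply: le_lt_trans (ltry M); apply: ge_ereal_sup => _ [i _ <-]; exact: le_fM.
have ub i : (f i <= ereal_sup [set f i | i in [set: I]]%classic)%E.
  by apply: ereal_sup_ubound; exists i.
move: sup_fin ub; case: (ereal_sup _) => [M|//|] _ ub; first by exists M.
by exists 0 => i; rewrite (le_trans (ub i)) // leNye.
Qed.

(** * The alpha-dual in terms of finite column sums *)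

Lemma bcoef_lt0 (R : realType) (q gamma : R) (n : int) :
  n < 0 -> bcoef q gamma n = 0.
Proof. by case: n. Qed.

Lemma bconv_sum (R : realType) (q gamma : R) (f : nat -> R[i]) N j :
  (j < N)%N ->
  bconv q gamma f j =
  \sum_(0 <= k < N) (bcoef q gamma (j%:Z - k%:Z))%:C * f k.
Proof.
move=> jN; rewrite (@big_cat_nat _ _ _ j.+1) //= [X in _ + X]big1_seq ?addr0.
  rewrite /bconv /conv !big_nat; apply: eq_bigr => k /andP[_ kj].
  by rewrite subzn // -ltnS.
move=> k /andP[_]; rewrite mem_index_iota => /andP[jk _].
by rewrite bcoef_lt0 ?mul0r // subr_lt0 ltz_nat.
Qed.

(** The sum of the first N entries, in modulus, of the k-th column of the
matrix (a_j b_(j-k)). *)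
Definition colsum (R : realType) (q gamma : R) (a : nat -> R[i]) (N k : nat) : R :=
  \sum_(0 <= j < N) bcoef q gamma (j%:Z - k%:Z) * normc (a j).

Lemma sum_colsum (R : realType) (q gamma : R) (a : nat -> R[i]) (f : nat -> R) N :
  \sum_(0 <= j < N) normc (a j) *
    \sum_(0 <= k < N) bcoef q gamma (j%:Z - k%:Z) * f k =
  \sum_(0 <= k < N) f k * colsum q gamma a N k.
Proof.
under eq_bigr do rewrite mulr_sumr.
rewrite exchange_big /=; apply: eq_bigr => k _.
by rewrite /colsum mulr_sumr; apply: eq_bigr => j _; ring.
Qed.

Lemma ell1P (R : realType) (f : nat -> R[i]) :
  ell 1 f <-> bounded_series (fun k => normc (f k)).
Proof.
rewrite -nneseries_ltyP; last by move=> k; exact: normc_ge0.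
by rewrite /ell /=; under eq_eseriesr do rewrite powRr1 ?normc_ge0 //.
Qed.

(** Only the moduli of f = nabla g matter: they bound the modulus of b * f since
b is nonnegative, and the bound is attained when f itself is nonnegative. *)
Lemma alpha_dual_nablaP (R : realType) (q gamma : R) (X : set (nat -> R[i]))
    (a : nat -> R[i]) :
  0 < q -> q < 1 -> 0 < gamma ->
  (forall f, X f -> X (fun k => (normc (f k))%:C)) ->
  alpha_dual (nabla_domain q gamma X) a <->
  forall f : nat -> R, (forall k, 0 <= f k) -> X (fun k => (f k)%:C) ->
    exists M, forall N, \sum_(0 <= k < N) f k * colsum q gamma a N k <= M.
Proof.
move=> q0 q1 g0 normX; split=> [dual f f0 Xf | bnd g Xg].
  have /dual/ell1P[M le_M] : nabla_domain q gamma X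
      (bconv q gamma (fun k => (f k)%:C)) by rewrite /nabla_domain /= nabla_bconv.
  exists M => N; rewrite -sum_colsum; apply: le_trans (le_M N).
  rewrite le_eqVlt; apply/orP; left; apply/eqP.
  rewrite !big_nat; apply: eq_bigr => j /andP[_ jN].
  rewrite normcM (bconv_sum _ _ _ jN); congr (_ * _).
  under [in RHS]eq_bigr do rewrite -[_%:C * _](rmorphM (real_complex R)).
  rewrite -(rmorph_sum (real_complex R)) normc_real ger0_norm //.
  by rewrite sumr_ge0 // => k _; rewrite mulr_ge0 ?bcoef_ge0.
have [M le_M] := bnd _ (fun k => normc_ge0 _) (normX _ Xg).
apply/ell1P; exists M => N; apply: le_trans (le_M N).
rewrite -sum_colsum !big_nat ler_sum // => j /andP[_ jN].
rewrite normcM ler_wpM2l ?normc_ge0 // -{1}(bconv_nabla gamma g q0 q1).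
rewrite (bconv_sum _ _ _ jN) (le_trans (normc_sum _ _ _)) // ler_sum // => k _.
by rewrite normc_realM ?bcoef_ge0.
Qed.

(** * The spaces of the statement in terms of finite column sums *)

Definition fset_below (P : pred nat) (N : nat) : {fset nat} :=
  [fset j in [seq j <- iota 0 N | P j]]%fset.

Lemma in_fset_below (P : pred nat) N j : (j \in fset_below P N) = P j && (j < N)%N.
Proof.
rewrite /fset_below in_fset -[LHS]/(j \in [seq j <- iota 0 N | P j]).
by rewrite mem_filter mem_iota.
Qed.

Lemma bsum_fset_below (R : realType) (q gamma : R) (a : nat -> R[i]) P N k :
  bsum q gamma a (fset_below P N) k =
  \sum_(0 <= j < N | P j) (bcoef q gamma (j%:Z - k%:Z))%:C * a j.
Proof.
rewrite /bsum /index_iota subn0 -[RHS]big_filter; apply: perm_big.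
apply: uniq_perm; rewrite ?fset_uniq ?filter_uniq ?iota_uniq //.
by move=> j; rewrite /fset_below in_fset.
Qed.

(** Applied with h = Re and h = Im.  On a set of indices where h (a j) has
constant sign, the sum of the b_(j-k) |h (a j)| is, up to sign, the value of h
at the corresponding [bsum].  That the two sets do not depend on k is what
allows summing over k afterwards. *)
Lemma sum_functional_le_bsum (R : realType) (q gamma : R) (a : nat -> R[i])
    (h : R[i] -> R) (hD : {morph h : z w / z + w}) (h0 : h 0 = 0)
    (hM : forall (x : R) z, h (x%:C * z) = x * h z)
    (h_le : forall z, `|h z| <= normc z) N k :
  \sum_(0 <= j < N) bcoef q gamma (j%:Z - k%:Z) * `|h (a j)| <=
  normc (bsum q gamma a (fset_below (fun j => 0 <= h (a j)) N) k) +
  normc (bsum q gamma a (fset_below (fun j => h (a j) < 0) N) k).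
Proof.
rewrite (bigID (fun j => 0 <= h (a j))) /=; apply: lerD.
  apply: le_trans (h_le _); apply: le_trans (ler_norm _).
  rewrite bsum_fset_below (big_morph h hD h0); apply: ler_sum => j hj.
  by rewrite hM ger0_norm.
apply: le_trans (h_le _); rewrite -normrN; apply: le_trans (ler_norm _).
rewrite bsum_fset_below (big_morph h hD h0) -sumrN.
under eq_bigl do rewrite -ltNge.
by apply: ler_sum => j hj; rewrite hM ltr0_norm // mulrN.
Qed.

Definition sign_part (R : realType) (a : nat -> R[i]) (N : nat) (i : 'I_4) :
    {fset nat} :=
  fset_below (nth xpred0 [:: (fun j => 0 <= complex.Re (a j));
                             (fun j => complex.Re (a j) < 0);
                             (fun j => 0 <= complex.Im (a j));
                             (fun j => complex.Im (a j) < 0)] i) N.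

Lemma colsum_le_bsum (R : realType) (q gamma : R) (a : nat -> R[i]) N k :
  0 < q -> q < 1 -> 0 < gamma ->
  colsum q gamma a N k <=
  \sum_(i < 4) normc (bsum q gamma a (sign_part a N i) k).
Proof.
move=> q0 q1 g0.
rewrite !big_ord_recl big_ord0 addr0 [leRHS]addrA /sign_part /=.
apply: (@le_trans _ _ (\sum_(0 <= j < N) bcoef q gamma (j%:Z - k%:Z) *
    (`|complex.Re (a j)| + `|complex.Im (a j)|))).
  by apply: ler_sum => j _; rewrite ler_wpM2l ?bcoef_ge0 ?normc_le_ReIm.
under eq_bigr do rewrite mulrDr.
rewrite big_split /=; apply: lerD; apply: sum_functional_le_bsum => //.
- by case=> [? ?] [].
- by move=> x [y z] /=; rewrite mul0r subr0.
- exact: Re_le_normc.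
- by case=> [? ?] [].
- by move=> x [y z] /=; rewrite mul0r addr0.
- exact: Im_le_normc.
Qed.

Lemma colsum_ge0 (R : realType) (q gamma : R) (a : nat -> R[i]) N k :
  0 < q -> q < 1 -> 0 < gamma -> 0 <= colsum q gamma a N k.
Proof.
by move=> *; apply: sumr_ge0 => j _; rewrite mulr_ge0 ?bcoef_ge0 ?normc_ge0.
Qed.

Lemma colsum_eq0 (R : realType) (q gamma : R) (a : nat -> R[i]) N k :
  (N <= k)%N -> colsum q gamma a N k = 0.
Proof.
move=> Nk; rewrite /colsum big1_seq // => j /andP[_].
rewrite mem_index_iota => /andP[_ jN].
by rewrite bcoef_lt0 ?mul0r // subr_lt0 ltz_nat (leq_trans jN).
Qed.

Lemma bsum_le_colsum (R : realType) (q gamma : R) (a : nat -> R[i])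
    (J : {fset nat}) :
  0 < q -> q < 1 -> 0 < gamma ->
  exists N, forall k, normc (bsum q gamma a J k) <= colsum q gamma a N k.
Proof.
move=> q0 q1 g0; exists (\max_(j <- J) j).+1 => k.
set N := _.+1.
have -> : J = fset_below (mem J) N.
  apply/fsetP => j; rewrite in_fset_below /=.
  case: (boolP (j \in J)) => jJ //=; rewrite ltnS.
  by rewrite (@leq_bigmax_seq _ _ predT id).
rewrite bsum_fset_below (le_trans (normc_sum _ _ _)) //.
rewrite /colsum [leRHS](bigID (mem J)) /= -[leLHS]addr0 lerD //.
  by apply: ler_sum => j _; rewrite normc_realM ?bcoef_ge0.
by rewrite sumr_ge0 // => j _; rewrite mulr_ge0 ?bcoef_ge0 ?normc_ge0.
Qed.

(** Some y i is at least x / (n + 1), which suffices for every s >= 0, whereas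
convexity of the power would require s >= 1. *)
Lemma powR_sum_le (R : realType) n (s x : R) (y : 'I_n.+1 -> R) :
  0 <= s -> 0 <= x -> (forall i, 0 <= y i) -> x <= \sum_i y i ->
  x `^ s <= n.+1%:R `^ s * \sum_i y i `^ s.
Proof.
move=> s0 x0 y0 le_xy.
have [i le_yi] : exists i, forall j, y j <= y i.
  by exists [arg max_(i > ord0) y i]%O; case: arg_maxP => // i _ h j; exact: h.
have le_x : x <= n.+1%:R * y i.
  apply: (le_trans le_xy); rewrite -[in leRHS](card_ord n.+1) mulr_natl -sumr_const.
  exact: ler_sum.
apply: le_trans (ge0_ler_powR s0 _ _ le_x) _; rewrite ?nnegrE ?mulr_ge0 //.
rewrite powRM // ler_wpM2l ?powR_ge0 // (bigD1 i) //= lerDl.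
by rewrite sumr_ge0 // => j _; exact: powR_ge0.
Qed.

Lemma powR_root (R : realType) (x p : R) : 0 <= x -> p != 0 ->
  (x `^ p) `^ p^-1 = x.
Proof. by move=> x0 p0; rewrite -powRrM divff // powRr1. Qed.

Lemma powR_le_root (R : realType) (x y p : R) : 0 <= x -> 0 < p ->
  x `^ p <= y -> x <= y `^ p^-1.
Proof.
move=> x0 p0 le_xy; rewrite -[leLHS](powR_root x0 (lt0r_neq0 p0)).
have y0 : 0 <= y by exact: le_trans (powR_ge0 _ _) le_xy.
by apply: ge0_ler_powR; rewrite ?nnegrE ?powR_ge0 // invr_ge0 ltW.
Qed.

Lemma S_supP (R : realType) (q gamma p : R) (a : nat -> R[i]) :
  0 < q -> q < 1 -> 0 < gamma -> 0 < p ->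
  S_sup q gamma p a <-> exists M, forall N k, colsum q gamma a N k <= M.
Proof.
move=> q0 q1 g0 p0; rewrite /S_sup /= ereal_sup_ltyP; split=> -[M le_M].
  exists (\sum_(i < 4) M `^ p^-1) => N k.
  rewrite (le_trans (colsum_le_bsum _ _ _ _ _ _)) // ler_sum // => i _.
  rewrite powR_le_root ?normc_ge0 // -lee_fin; apply: le_trans (le_M _).
  by apply: ereal_sup_ubound; exists k.
exists (M `^ p) => J; have [N le_J] := bsum_le_colsum a J q0 q1 g0.
apply: ge_ereal_sup => _ [k _ <-]; rewrite lee_fin.
have le_JM := le_trans (le_J k) (le_M N k).
apply: ge0_ler_powR; rewrite ?nnegrE ?normc_ge0 ?(ltW p0) //.
exact: le_trans (normc_ge0 _) le_JM.
Qed.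

Lemma S_sumP (R : realType) (q gamma s : R) (a : nat -> R[i]) :
  0 < q -> q < 1 -> 0 < gamma -> 0 < s ->
  S_sum q gamma s a <->
  exists M, forall N, \sum_(0 <= k < N) colsum q gamma a N k `^ s <= M.
Proof.
move=> q0 q1 g0 s0; rewrite /S_sum /= ereal_sup_ltyP; split=> -[M le_M].
  exists (4%:R `^ s * \sum_(i < 4) M) => N.
  apply: le_trans (_ : \sum_(0 <= k < N) 4%:R `^ s * \sum_(i < 4)
      normc (bsum q gamma a (sign_part a N i) k) `^ s <= _).
    apply: ler_sum => k _; apply: powR_sum_le; rewrite ?(ltW s0) ?colsum_ge0 //.
      by move=> i; exact: normc_ge0.
    exact: colsum_le_bsum.
  rewrite -mulr_sumr ler_wpM2l ?powR_ge0 // exchange_big ler_sum // => i _.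
  move: (le_M (sign_part a N i)) => /nneseries_leP -> // k.
  exact: powR_ge0.
exists M => J; have [N le_J] := bsum_le_colsum a J q0 q1 g0.
apply/nneseries_leP => [k|K]; first exact: powR_ge0.
apply: le_trans (le_M N).
(* The column sums over j < N vanish for k >= N, so their sum over k < N already
   bounds every partial sum over k < K. *)
have -> : \sum_(0 <= k < N) colsum q gamma a N k `^ s =
          \sum_(0 <= k < maxn K N) colsum q gamma a N k `^ s.
  rewrite [RHS](@big_cat_nat _ _ _ N) ?leq_maxr //=.
  rewrite [X in _ + X]big1_seq ?addr0 // => k /andP[_].
  rewrite mem_index_iota => /andP[Nk _].
  by rewrite colsum_eq0 // powR0 // lt0r_neq0.
rewrite [leRHS](@big_cat_nat _ _ _ K) ?leq_maxl //= -[leLHS]addr0 lerD //.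
  apply: ler_sum => k _; apply: ge0_ler_powR => //; first exact: ltW.
    by rewrite nnegrE normc_ge0.
  by rewrite nnegrE colsum_ge0.
by rewrite sumr_ge0 // => k _; exact: powR_ge0.
Qed.

(** * Duality of the sequence spaces for nonnegative arrays *)

Lemma ellP (R : realType) (p : R) (f : nat -> R[i]) :
  ell p f <-> bounded_series (fun k => normc (f k) `^ p).
Proof. by apply: nneseries_ltyP => k; exact: powR_ge0. Qed.

Lemma ell_realP (R : realType) (p : R) (f : nat -> R) : (forall k, 0 <= f k) ->
  ell p (fun k => (f k)%:C) <-> bounded_series (fun k => f k `^ p).
Proof.
move=> f0; rewrite ellP.
by under eq_fun do rewrite normc_real ger0_norm //.
Qed.

Lemma sum_half_pow (R : realType) n :
  \sum_(0 <= i < n) 2%:R ^- i.+1 = 1 - 2%:R ^- n :> R.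
Proof.
elim: n => [|n IH]; first by rewrite big_geq // expr0 invr1 subrr.
by rewrite big_nat_recr //= IH exprS; field.
Qed.

(** The function g is the l_p combination (sum_n 2^-(n+1) f_n^p)^(1/p) of the
f_n: it stays in the unit ball and dominates each f_n up to a factor that
depends on n only.  Taking p-th powers before summing makes the construction
work for p < 1, where l_p is not normed. *)
Lemma gliding_hump (R : realType) (p : R) (f : nat -> nat -> R) : 0 < p ->
  (forall n k, 0 <= f n k) ->
  (forall n N, \sum_(0 <= k < N) f n k `^ p <= 1) ->
  exists g : nat -> R, [/\ forall k, 0 <= g k,
    bounded_series (fun k => g k `^ p) &
    forall n k, (2%:R ^- n.+1) `^ p^-1 * f n k <= g k].
Proof.
move=> p0 f0 f_le1; set w : nat -> R := fun n => 2%:R ^- n.+1.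
have w0 n : 0 <= w n by rewrite invr_ge0 exprn_ge0.
have wf0 n k : 0 <= w n * f n k `^ p by rewrite mulr_ge0 ?powR_ge0.
have wfE n k : (0 <= (w n * f n k `^ p)%:E)%E by rewrite lee_fin.
pose S k := (\sum_(0 <= n <oo) (w n * f n k `^ p)%:E)%E.
have S0 k : (0 <= S k)%E by apply: nneseries_ge0.
have sumS N : (\sum_(0 <= k < N) S k <= 1%:E)%E.
  rewrite /S -nneseries_sum_nat //.
  under eq_eseriesr do rewrite sumEFin -mulr_sumr.
  apply/nneseries_leP => [n|m].
    by rewrite mulr_ge0 // sumr_ge0 // => k _; exact: powR_ge0.
  apply: (@le_trans _ _ (\sum_(0 <= n < m) w n)).
    by apply: ler_sum => n _; rewrite ler_piMr.
  by rewrite sum_half_pow gerBl invr_ge0 exprn_ge0.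
have S_le1 k : (S k <= 1%:E)%E.
  apply: le_trans (sumS k.+1); rewrite big_nat_recr //=.
  by rewrite leeDr // sume_ge0.
have S_fin k : S k \is a fin_num.
  by rewrite ge0_fin_numE // (le_lt_trans (S_le1 k)) // ltry.
have fS0 k : 0 <= fine (S k) by rewrite fine_ge0.
exists (fun k => fine (S k) `^ p^-1); split=> [k||n k].
- exact: powR_ge0.
- exists 1 => N; under eq_bigr do rewrite -powRrM mulVf ?lt0r_neq0 // powRr1 //.
  by rewrite -lee_fin -sumEFin; under eq_bigr do rewrite fineK //.
- rewrite -[f n k](powR_root (f0 n k) (lt0r_neq0 p0)) -powRM ?w0 ?powR_ge0 //.
  apply: ge0_ler_powR; rewrite ?invr_ge0 ?(ltW p0) ?nnegrE ?wf0 //.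
  rewrite -lee_fin fineK //; apply: le_trans (nneseries_lim_ge n.+1 _) => //.
  by rewrite big_nat_recr //= leeDr // sume_ge0.
Qed.

(** Otherwise, for each n, some f_n in the unit ball has a sum exceeding
n / c_n, where c_n is the factor of [gliding_hump]; the g dominating all the
c_n f_n then has sums exceeding every n. *)
Lemma uniform_bound (R : realType) (p : R) (B : nat -> nat -> R) : 0 < p ->
  (forall N k, 0 <= B N k) ->
  (forall f, (forall k, 0 <= f k) -> bounded_series (fun k => f k `^ p) ->
     exists M, forall N, \sum_(0 <= k < N) f k * B N k <= M) ->
  exists M, forall f, (forall k, 0 <= f k) ->
     (forall N, \sum_(0 <= k < N) f k `^ p <= 1) ->
     forall N, \sum_(0 <= k < N) f k * B N k <= M.
Proof.
move=> p0 B0 bnd; apply: contrapT => unbounded.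
set c : nat -> R := fun n => (2%:R ^- n.+1) `^ p^-1.
have c0 n : 0 < c n by rewrite powR_gt0 // invr_gt0 exprn_gt0.
have /choice[f fP] n : exists f : nat -> R, [/\ forall k, 0 <= f k,
    forall N, \sum_(0 <= k < N) f k `^ p <= 1 &
    exists N, n%:R / c n < \sum_(0 <= k < N) f k * B N k].
  apply: contrapT => nof; apply: unbounded; exists (n%:R / c n) => f f0 f1 N.
  rewrite leNgt; apply/negP => lt_f; apply: nof; exists f; split=> //.
  by exists N.
have [||g [g0 gp le_fg]] := @gliding_hump _ p f p0.
- by move=> n; case: (fP n).
- by move=> n; case: (fP n).
have [M le_M] := bnd g g0 gp.
have [n ltMn] : exists n, M < n%:R.
  by exists (Num.bound M); exact: unstable.ltr_bound.
have [_ _ [N]] := fP n; rewrite ltr_pdivrMr // mulr_suml => lt_f.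
suff /le_lt_trans/(_ ltMn) : n%:R <= M by rewrite ltxx.
apply: le_trans (le_M N); apply: le_trans (ltW lt_f) _.
apply: ler_sum => k _; rewrite mulrAC [_ * c n]mulrC ler_wpM2r //.
exact: le_fg.
Qed.

(** Sufficiency: f in l_p is bounded, so f = f^(1-p) f^p is at most a constant
times f^p and f is summable.  Necessity: test the uniform bound on unit
vectors. *)
Lemma ell_le1_dualP (R : realType) (p : R) (B : nat -> nat -> R) :
  0 < p -> p <= 1 -> (forall N k, 0 <= B N k) ->
  (forall N k, (N <= k)%N -> B N k = 0) ->
  (forall f, (forall k, 0 <= f k) -> bounded_series (fun k => f k `^ p) ->
     exists M, forall N, \sum_(0 <= k < N) f k * B N k <= M) <->
  exists M, forall N k, B N k <= M.
Proof.
move=> p0 p1 B0 B_eq0.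
split=> [/(uniform_bound p0 B0)[M le_M]|[M le_M] f f0 [L le_L]].
  exists (Num.max M 0) => N k; have [Nk|kN] := leqP N k.
    by rewrite B_eq0 // le_max lexx orbT.
  rewrite le_max; apply/orP; left.
  have := le_M (fun i => (i == k)%:R) (fun i => ler0n _ _) _ N.
  rewrite (bigD1_seq k) ?mem_index_iota ?iota_uniq //= eqxx mul1r big1.
    rewrite addr0; apply=> K.
    under eq_bigr => i _.
      rewrite (_ : _ `^ p = (i == k)%:R); first over.
      by case: eqP => _; rewrite ?powR1 ?powR0 // lt0r_neq0.
    have [kK|Kk] := ltnP k K.
      rewrite (bigD1_seq k) ?mem_index_iota ?iota_uniq //= eqxx big1 ?addr0 //.
      by move=> i /negbTE ->.
    rewrite big1_seq // => i /andP[_]; rewrite mem_index_iota => /andP[_ iK].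
    by rewrite ltn_eqF // (leq_trans iK).
  by move=> i /negbTE ->; rewrite mul0r.
have L0 : 0 <= L by have := le_L 0%N; rewrite big_geq.
have M0 : 0 <= M := le_trans (B0 0%N 0%N) (le_M 0%N 0%N).
have fpL k : f k `^ p <= L.
  apply: le_trans (le_L k.+1); rewrite big_nat_recr //= lerDr sumr_ge0 // => i _.
  exact: powR_ge0.
have f_le k : f k <= (L `^ p^-1) `^ (1 - p) * f k `^ p.
  have [->|fk0] := eqVneq (f k) 0; first by rewrite mulr_ge0 ?powR_ge0.
  rewrite -{1}[f k]powRr1 // -{1}(subrK p 1) powRD ?fk0 ?implybT //.
  rewrite ler_wpM2r ?powR_ge0 //.
  apply: ge0_ler_powR; rewrite ?nnegrE ?powR_ge0 ?subr_ge0 //.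
  exact: powR_le_root.
exists ((L `^ p^-1) `^ (1 - p) * L * M) => N.
apply: (@le_trans _ _ (\sum_(0 <= k < N) (L `^ p^-1) `^ (1 - p) * f k `^ p * M)).
  by apply: ler_sum => k _; exact: ler_pM.
by rewrite -mulr_suml -mulr_sumr ler_wpM2r // ler_wpM2l // powR_ge0.
Qed.

Lemma conjugate_gt0 (R : realType) (p p' : R) :
  1 < p -> p^-1 + p'^-1 = 1 -> 0 < p'.
Proof.
move=> p1 pp'; rewrite -invr_gt0 -(addrK p^-1 p'^-1) [_ + p^-1]addrC pp'.
by rewrite subr_gt0 invf_lt1 // (lt_trans _ p1).
Qed.

(** Sufficiency is Young's inequality.  Necessity: with
S = sum_(k < N) B_N(k)^p', the test function B_N^(p'-1) / S^(1/p) lies in the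
unit ball and its pairing with B_N is S^(1/p'). *)
Lemma ell_conjugate_dualP (R : realType) (p p' : R) (B : nat -> nat -> R) :
  1 < p -> p^-1 + p'^-1 = 1 -> (forall N k, 0 <= B N k) ->
  (forall f, (forall k, 0 <= f k) -> bounded_series (fun k => f k `^ p) ->
     exists M, forall N, \sum_(0 <= k < N) f k * B N k <= M) <->
  exists M, forall N, \sum_(0 <= k < N) B N k `^ p' <= M.
Proof.
move=> p1 pp' B0; have p0 : 0 < p by exact: lt_trans p1.
have p'0 : 0 < p' := conjugate_gt0 p1 pp'.
split=> [/(uniform_bound p0 B0)[M le_M]|[M le_M] f f0 [L le_L]].
  exists (M `^ p') => N; set S := \sum_(0 <= k < N) _.
  have S0 : 0 <= S by rewrite sumr_ge0 // => k _; exact: powR_ge0.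
  have [->|Sn0] := eqVneq S 0; first exact: powR_ge0.
  pose f k := if (k < N)%N then B N k `^ (p' - 1) * S `^ (- p^-1) else 0.
  have f0 k : 0 <= f k by rewrite /f; case: ifP => // _; rewrite mulr_ge0 ?powR_ge0.
  have pp'B : (p' - 1) * p = p'.
    move: pp' => /(congr1 (fun x => x * p * p')).
    rewrite mulrDl mulrDl mulVf ?lt0r_neq0 // mul1r mulrAC mulVf ?lt0r_neq0 //.
    by rewrite !mul1r => E; lra.
  have fpE k : (k < N)%N -> f k `^ p = B N k `^ p' / S.
    move=> kN; rewrite /f kN powRM ?powR_ge0 // -!powRrM pp'B.
    rewrite mulNr mulVf ?lt0r_neq0 //.
    by rewrite powR_inv1.
  have f1 K : \sum_(0 <= k < K) f k `^ p <= 1.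
    apply: (@le_trans _ _ (\sum_(0 <= k < maxn K N) f k `^ p)).
      rewrite [leRHS](@big_cat_nat _ _ _ K) ?leq_maxl //= lerDl sumr_ge0 // => k _.
      exact: powR_ge0.
    rewrite (@big_cat_nat _ _ _ N) ?leq_maxr //= [X in _ + X]big1_seq ?addr0.
      rewrite big_nat; under eq_bigr => k /andP[_ kN] do rewrite fpE //.
      by rewrite -big_nat -mulr_suml divff.
    move=> k /andP[_]; rewrite mem_index_iota => /andP[Nk _].
    by rewrite /f ltnNge Nk powR0 ?lt0r_neq0.
  have := le_M f f0 f1 N.
  rewrite big_nat; under eq_bigr => k /andP[_ kN].
    rewrite /f kN mulrAC [_ * B N k]mulrC mulr_powRB1 //; over.
  rewrite -big_nat -mulr_suml -/S -{1}[S]powRr1 // -powRD ?Sn0 ?implybT //.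
  rewrite -pp' addrAC subrr add0r => le_SM.
  rewrite -[leLHS](powR_root S0 (invr_neq0 (lt0r_neq0 p'0))) invrK.
  apply: ge0_ler_powR; rewrite ?nnegrE ?(ltW p'0) ?powR_ge0 //.
  exact: le_trans (powR_ge0 _ _) le_SM.
exists (L / p + M / p') => N.
apply: le_trans (_ : \sum_(0 <= k < N) (f k `^ p / p + B N k `^ p' / p') <= _).
  by apply: ler_sum => k _; exact: conjugate_powR.
rewrite big_split /= -!mulr_suml; apply: lerD;
  rewrite ler_wpM2r ?invr_ge0 ?(ltW p0) ?(ltW p'0) //.
Qed.

Lemma ell_inftyP (R : realType) (f : nat -> R[i]) :
  ell_infty f <-> exists M, forall k, normc (f k) <= M.
Proof. by rewrite /ell_infty /= ereal_sup_ltyP. Qed.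

Theorem theorem3p1 (R : realType) (q gamma : R)
    (q_gt0 : 0 < q) (q_lt1 : q < 1) (gamma_gt0 : 0 < gamma) :
  [/\ (forall p : R, 0 < p -> p <= 1 ->
         alpha_dual (nabla_domain q gamma (@ell R p)) = S_sup q gamma p),
      (forall p p' : R, 1 < p -> p^-1 + p'^-1 = 1 ->
         alpha_dual (nabla_domain q gamma (@ell R p)) = S_sum q gamma p')
    & alpha_dual (nabla_domain q gamma (@ell_infty R)) = S_sum q gamma 1].
Proof.
have c0 a N k : 0 <= colsum q gamma a N k by exact: colsum_ge0.
have ell_norm (p : R) f : ell p f -> ell p (fun k => (normc (f k))%:C).
  by rewrite ell_realP ?ellP // => k; exact: normc_ge0.
split.
- move=> p p0 p1; apply/seteqP.
  suff E a : alpha_dual (nabla_domain q gamma (@ell R p)) a <-> S_sup q gamma p a.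
    by split=> a /E.
  have := alpha_dual_nablaP a q_gt0 q_lt1 gamma_gt0 (ell_norm p).
  have := ell_le1_dualP p0 p1 (c0 a) (@colsum_eq0 _ q gamma a).
  rewrite S_supP // => <- ->.
  by split=> H f f0 Hf; apply: H => //; apply/ell_realP.
- move=> p p' p1 pp'; apply/seteqP.
  suff E a : alpha_dual (nabla_domain q gamma (@ell R p)) a <-> S_sum q gamma p' a.
    by split=> a /E.
  have p'0 : 0 < p' := conjugate_gt0 p1 pp'.
  have := alpha_dual_nablaP a q_gt0 q_lt1 gamma_gt0 (ell_norm p).
  rewrite S_sumP // -(ell_conjugate_dualP p1 pp' (c0 a)) => ->.
  by split=> H f f0 Hf; apply: H => //; apply/ell_realP.
- apply/seteqP.
  suff E a : alpha_dual (nabla_domain q gamma (@ell_infty R)) a <-> S_sum q gamma 1 a.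
    by split=> a /E.
  rewrite alpha_dual_nablaP //; last first.
    move=> f; rewrite !ell_inftyP => -[M le_M]; exists M => k.
    by rewrite normc_real ger0_norm ?normc_ge0.
  rewrite S_sumP //; split=> [dual|[M le_M] f f0].
    have [|M le_M] := dual (fun=> 1) (fun=> ler01).
      by apply/ell_inftyP; exists 1 => k; rewrite normc_real normr1.
    by exists M => N; under eq_bigr do rewrite powRr1 // -[colsum _ _ _ _ _]mul1r.
  move=> /ell_inftyP[L le_L].
  have {}le_L k : f k <= L by rewrite -[f k]ger0_norm // -normc_real.
  exists (L * M) => N.
  apply: (@le_trans _ _ (L * \sum_(0 <= k < N) colsum q gamma a N k `^ 1)).
    by rewrite mulr_sumr; apply: ler_sum => k _; rewrite powRr1 // ler_wpM2r.
  by rewrite ler_wpM2l // (le_trans (f0 0%N)).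
Qed.
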